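(* Let $X, Y$ be positive integers and let $(o_m)_{1\le m\le Y}$ be an orthonormal basis of $\mathbb{R}^Y$. Let $\Upsilon$ be a function such that $$(\forall u\in\mathbb{R}^Y)\qquad \Upsilon(u)=\sum_{m=1}^Y \psi_m(o_m^\top u),$$ where $(\psi_m)_{1\le m\le Y}$ are functions in $\Gamma_0(\mathbb{R})$. Let $L$ be a matrix in $\mathbb{R}^{Y\times X}$ such that $$D := LL^\top=\sum_{m=1}^Y \Delta_m\, o_m o_m^\top,$$ where $(\Delta_m)_{1\le m\le Y}$ is a sequence of positive reals. Then $\Upsilon\circ L\in\Gamma_0(\mathbb{R}^X)$ and, for every $v\in\mathbb{R}^X$, $$\mathrm{prox}_{\Upsilon\circ L}\,v = v+L^\top D^{-1}\big(\mathrm{prox}_{D\Upsilon}(Lv)-Lv\big),$$ where $D\Upsilon$ is the function defined by $$(\forall u\in\mathbb{R}^Y)\qquad D\Upsilon(u)=\sum_{m=1}^Y \Delta_m\,\psi_m(o_m^\top u).$$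
   Context: For a positive integer $n$, $\Gamma_0(\mathbb{R}^n)$ denotes the class of lower semicontinuous convex functions $\varphi:\mathbb{R}^n\to\,]-\infty,+\infty]$ that are proper (not identically equal to $+\infty$). For $\varphi\in\Gamma_0(\mathbb{R}^n)$, the proximity operator $\mathrm{prox}_\varphi:\mathbb{R}^n\to\mathbb{R}^n$ maps $u$ to the unique minimizer over $v\in\mathbb{R}^n$ of $\frac12\|v-u\|^2+\varphi(v)$, where $\|\cdot\|$ is the Euclidean norm. The matrix $L$ is identified with the linear map $\mathbb{R}^X\to\mathbb{R}^Y$ it defines. $D\Upsilon$ is notation for the function defined in the claim (it is not the product of the matrix $D$ with the values of $\Upsilon$). *)

(* Defs.v *)
From HB Require Import structures.
From mathcomp Require Import all_boot all_order all_algebra.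
From mathcomp Require Import all_classical all_reals all_analysis.

Set Implicit Arguments.
Unset Strict Implicit.
Unset Printing Implicit Defensive.

Import Order.TTheory GRing.Theory Num.Theory.
Import numFieldNormedType.Exports.

Local Open Scope classical_set_scope.
Local Open Scope ring_scope.

(* MathComp-Analysis only defines convexity of finite-valued functions.  In
   [\bar R], [0 * +oo = 0], but only [0 < t < 1] is used here. *)
Definition convex_ereal (R : realType) (E : lmodType R) (phi : E -> \bar R) :=
  forall (x y : E) (t : R), 0 < t < 1 ->
    (phi (t *: x + (1 - t) *: y)%R <= t%:E * phi x + (1 - t)%:E * phi y)%E.

(* [\bar R] contains [-oo], hence the first clause.  The sup norm that MathComp
   puts on ['cV[R]_n] induces the usual topology; the real line is [R^o]. *)
Definition Gamma0 (R : realType) (E : normedModType R) : set (E -> \bar R) :=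
  [set phi | [/\ forall x, phi x != -oo%E,
                 lower_semicontinuous phi,
                 convex_ereal phi
               & exists x, phi x != +oo%E]].

Section Euclidean.
Variables (R : realType) (n : nat).
Implicit Types (u v p : 'cV[R]_n) (phi : 'cV[R]_n -> \bar R).

Definition dotv u v : R := \sum_(i < n) u i ord0 * v i ord0.

(* The library norm of ['cV[R]_n] is the sup norm. *)
Definition enorm u : R := Num.sqrt (dotv u u).

Definition orthonormal_basis (o : 'I_n -> 'cV[R]_n) : Prop :=
  basis_of fullv [tuple o m | m < n] /\
  forall i j, dotv (o i) (o j) = (i == j)%:R.

Definition prox_obj phi u v : \bar R := ((2^-1 * enorm (v - u) ^+ 2)%:E + phi v)%E.

Definition minimizer (f : 'cV[R]_n -> \bar R) : set 'cV[R]_n :=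
  [set p | forall v, (f p <= f v)%E].

(* Total function: the unique minimizer if there is one, and an unspecified
   vector otherwise. *)
Definition prox phi u : 'cV[R]_n :=
  get [set p | unique (minimizer (prox_obj phi u)) p].

End Euclidean.

(* Main.v *)
Require Import Defs.
From HB Require Import structures.
From mathcomp Require Import all_boot all_order all_algebra.
From mathcomp Require Import all_classical all_reals all_analysis.
From mathcomp Require Import ring lra.

Set Implicit Arguments.
Unset Strict Implicit.
Unset Printing Implicit Defensive.

Import Order.TTheory GRing.Theory Num.Theory.
Import numFieldNormedType.Exports.

Local Open Scope classical_set_scope.
Local Open Scope ring_scope.

(** Since [L *m L^T] is diagonal in the orthonormal basis [o], the vectors
    [L^T *m o m] are pairwise orthogonal, with squared lengths [Delta m].
    Hence [w = x - v] splits orthogonally into its projection on their span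
    and a remainder [z], and the Bessel identity

      |w|^2 = |z|^2 + \sum_m <o_m, L w>^2 / Delta_m

    turns the objective that defines the prox of [Upsilon \o L] at [v] into

      |z|^2 / 2 + \sum_m (<o_m, L x> - <o_m, L v>)^2 / (2 Delta_m)
                          + psi_m <o_m, L x>,

    in which [z] and the coordinates [<o_m, L x>] vary independently. So the
    unique minimizer has [z = 0] and [<o_m, L x> = p_m], where [p_m] minimizes
    [(t - <o_m, L v>)^2 / (2 Delta_m) + psi_m t] over the reals; explicitly it
    is [v + \sum_m (p_m - <o_m, L v>) / Delta_m *: (L^T *m o_m)]
    ([prox_separable_comp]).

    The same lemma with [L] the identity, all [Delta_m] equal to 1 and
    [Delta_m psi_m] in place of [psi_m] computes the prox of [D Upsilon] at
    [L v]. Its one-dimensional objectives are those above multiplied by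
    [Delta_m], so the same [p_m] occur, and
    [D^-1 o_m = Delta_m^-1 o_m] makes the two formulas agree.

    The existence of the [p_m] is [quadratic_Gamma0_strict_min]: a function of
    [Gamma0] on the line has a lower bound that is affine in the distance to a
    point of its domain, so adding a quadratic makes it coercive, and a lower
    semicontinuous function attains its minimum on a segment. Strictness of
    the minimum comes from the strict convexity of the square. *)

(** * Lower semicontinuous functions *)

(** The sublevel sets of the values that [f] takes on [A] are totally ordered,
    so they generate a filter; by lower semicontinuity every cluster point of
    this filter is a minimizer. *)
Lemma lsc_compact_min (R : realType) (T : topologicalType) (f : T -> \bar R)
    (A : set T) :
  lower_semicontinuous f -> compact A -> A !=set0 ->
  exists2 c, A c & forall x, A x -> (f c <= f x)%E.
Proof.
move=> fl cA [a Aa].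
pose sub x := [set y | A y /\ (f y <= f x)%E].
pose F : set_system T := [set S | exists2 x, A x & sub x `<=` S].
have FF : ProperFilter F.
  split; first by move=> [x Ax /(_ x)]; apply; split.
  split.
  - by exists a.
  - move=> S1 S2 [x1 A1 s1] [x2 A2 s2].
    have [le12|/ltW le21] := leP (f x1) (f x2).
      exists x1 => // y [Ay yx]; split; first exact: s1.
      by apply: s2; split=> //; exact: le_trans le12.
    exists x2 => // y [Ay yx]; split; last exact: s2.
    by apply: s1; split=> //; exact: le_trans le21.
  - by move=> S1 S2 S12 [x Ax sx]; exists x => //; exact: subset_trans S12.
have FA : F A by exists a => // y [].
have [c [Ac clc]] := cA F FF FA.
exists c => // x Ax; rewrite leNgt; apply/negP => fxc.
have [b fxb bfc] : exists2 b : R, (f x <= b%:E)%E & (b%:E < f c)%E.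
  move: fxc; case: (f x) => [r||] fxc; first by exists r.
  - by rewrite ltNge leey in fxc.
  - move: fxc; case: (f c) => [s||] // _.
    + by exists (s - 1); rewrite ?leNye // lte_fin ltrBlDr ltrDl.
    + by exists 0; rewrite ?leNye ?ltry.
have [V cV Vb] := fl c b bfc.
have Fsub : F (sub x) by exists x.
have [y [[Ay yx] Vy]] := clc _ _ Fsub cV.
by have := Vb y Vy; rewrite ltNge (le_trans yx).
Qed.

Lemma lsc_comp (R : realType) (S T : topologicalType) (g : S -> T)
    (f : T -> \bar R) :
  continuous g -> lower_semicontinuous f -> lower_semicontinuous (f \o g).
Proof.
move=> gc fl x a /= axf; have [V xV Va] := fl _ _ axf.
by exists (g @^-1` V); [exact: gc | move=> y; exact: Va].
Qed.

Lemma continuous_lsc (R : realType) (T : topologicalType) (h : T -> R) :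
  continuous h -> lower_semicontinuous (EFin \o h).
Proof.
move=> hc x a /=; rewrite lte_fin => ax.
exists (h @^-1` [set y | a < y]); last by move=> y /=; rewrite lte_fin.
by apply: hc; exact: lt_nbhsr.
Qed.

Lemma lscD (R : realType) (T : topologicalType) (f g : T -> \bar R) :
  (forall x, f x != -oo%E) -> (forall x, g x != -oo%E) ->
  lower_semicontinuous f -> lower_semicontinuous g ->
  lower_semicontinuous (fun x => (f x + g x)%E).
Proof.
move=> fN gN fl gl x a afg.
have [b [c [bf cg abc]]] : exists b c : R,
    [/\ (b%:E < f x)%E, (c%:E < g x)%E & a <= b + c].
  move: (fN x) (gN x) afg.
  case: (f x) (g x) => [r||] [s||] // _ _.
  - rewrite -EFinD lte_fin => ars.
    exists (r - (r + s - a) / 2), (s - (r + s - a) / 2).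
    by rewrite !lte_fin; split; lra.
  - by exists (r - 1), (a - r + 1); rewrite lte_fin ltry; split=> //; lra.
  - by exists (a - s + 1), (s - 1); rewrite lte_fin ltry; split=> //; lra.
  - by exists a, 0; rewrite !ltry addr0.
have [U xU Ub] := fl _ _ bf; have [V xV Vc] := gl _ _ cg.
exists (U `&` V); first exact: filterI.
move=> y [Uy Vy]; apply: le_lt_trans (lteD (Ub y Uy) (Vc y Vy)).
by rewrite -EFinD lee_fin.
Qed.

Lemma lsc_sum (R : realType) (T : topologicalType) (n : nat)
    (f : 'I_n -> T -> \bar R) :
  (forall m x, f m x != -oo%E) -> (forall m, lower_semicontinuous (f m)) ->
  lower_semicontinuous (fun x => \sum_(m < n) f m x)%E.
Proof.
elim: n f => [|n IHn] f fN fl.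
  by move=> x a; rewrite big_ord0 => a0; exists setT => [|y _];
    [exact: filterT | rewrite big_ord0].
under eq_fun do rewrite big_ord_recl.
apply: lscD => // [x|]; last exact: IHn.
by rewrite esum_eqNy; apply/existsPn => i; rewrite negb_and fN orbT.
Qed.

(** * Minimizing a quadratic plus a convex function on the line *)

(** Lower semicontinuity at [t0] bounds [g] below by [g t0 - 1] on a small
    interval of radius [e]; by convexity [g] cannot fall faster than with slope
    [e^-1] outside of it, or the chord to [t0] would pass below that bound. This
    elementary estimate replaces a supporting line. *)
Lemma Gamma0_affine_lower_bound (R : realType) (g : R^o -> \bar R) (t0 : R) :
  Gamma0 g -> g t0 != +oo%E ->
  exists2 K : R, 0 <= K &
    forall t, ((fine (g t0) - 1 - K * `|t - t0|)%:E <= g t)%E.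
Proof.
move=> [gN gl gc _] gy0.
have [a ga] : exists a : R, g t0 = a%:E.
  by move: (gN t0) gy0; case: (g t0) => // a _ _; exists a.
rewrite ga /=.
have [|V tV Va] := gl t0 (a - 1); first by rewrite ga lte_fin ltrBlDr ltrDl.
move: tV => /nbhs_ballP[d /= d0 dV].
have [e e0 ed] : exists2 e, 0 < e & e < d by exists (d / 2); lra.
have near t : `|t - t0| <= e -> ((a - 1)%:E < g t)%E.
  move=> te; apply: Va; apply: dV; rewrite /ball /= distrC.
  exact: le_lt_trans te _.
exists e^-1; first by rewrite invr_ge0 ltW.
move=> t; have [te|et] := leP `|t - t0| e.
  apply: le_trans (ltW (near t te)); rewrite lee_fin gerDl oppr_le0.
  by rewrite mulr_ge0 // invr_ge0 ltW.
have n0 : 0 < `|t - t0| by exact: lt_trans et.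
(* [s] below is the point of the chord from [t0] to [t] at distance [e]. *)
pose l := e / `|t - t0|.
have l01 : 0 < l < 1 by rewrite divr_gt0 //= ltr_pdivrMr // mul1r.
have /andP[l0 l1] := l01.
pose s : R := l * t + (1 - l) * t0.
have : (g s <= l%:E * g t + (1 - l)%:E * g t0)%E := gc t t0 l l01.
have sE : s - t0 = l * (t - t0) by rewrite /s; ring.
rewrite ga.
have : ((a - 1)%:E < g s)%E.
  by apply: near; rewrite sE normrM gtr0_norm // /l mulfVK ?lexx // lt0r_neq0.
move=> /lt_le_trans h /h {h}.
have lE : e^-1 * `|t - t0| = l^-1 by rewrite -[LHS]invrK invfM invrK.
rewrite lE.
move: (gN t); case: (g t) => [b||] // _; last by rewrite leey.
rewrite -!EFinM -EFinD lte_fin lee_fin => h.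
have lV : l * l^-1 = 1 by rewrite divff // gt_eqF.
rewrite -(ler_pM2l l0) !mulrBr lV; lra.
Qed.

(** This is existence and uniqueness of the proximal point in dimension one. The
    minimum value is finite, and the strict inequality is the form of uniqueness
    that adds up over coordinates. *)
Lemma quadratic_Gamma0_strict_min (R : realType) (g : R^o -> \bar R)
    (c k : R) :
  Gamma0 g -> 0 < k ->
  exists2 p : R, g p \is a fin_num & forall t, t != p ->
    ((k * (p - c) ^+ 2)%:E + g p < (k * (t - c) ^+ 2)%:E + g t)%E.
Proof.
move=> Gg k0; have [gN gl gc [t0 gy0]] := Gg.
have [K K0 gK] := Gamma0_affine_lower_bound Gg gy0.
have [a ga] : exists a : R, g t0 = a%:E.
  by move: (gN t0) gy0; case: (g t0) => // a _ _; exists a.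
rewrite ga /= in gK.
pose q t := ((k * (t - c) ^+ 2)%:E + g t)%E.
have qN t : q t != -oo%E.
  by rewrite /q; move: (gN t); case: (g t).
have ql : lower_semicontinuous (q : R^o -> \bar R).
  apply: lscD => //; apply: (@continuous_lsc R R^o).
  move=> t; apply: cvgM; first exact: cvg_cst.
  by apply: cvgM; apply: cvgB; (exact: cvg_id || exact: cvg_cst).
(* Beyond distance [B] from [t0] the quadratic beats the slope [K]; the final
   [+ 1] ensures [1 <= B], so that [1 <= `|t - t0|] absorbs the constant. *)
pose B := (K + 2 * k * `|t0 - c| + 1) / k + 1.
have kB : k * (B - 1) = K + 2 * k * `|t0 - c| + 1.
  by rewrite /B addrK mulrC mulfVK // gt_eqF.
have B1 : 1 <= B.
  have : 0 <= k * (B - 1).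
    by rewrite kB !addr_ge0 // !mulr_ge0 // ltW.
  by rewrite pmulr_rge0 // subr_ge0.
have far t : B <= `|t - t0| -> (q t0 <= q t)%E.
  move=> Bt; rewrite /q ga -EFinD.
  apply: le_trans (leeD (lexx _) (gK t)); rewrite -EFinD lee_fin.
  set s := t - t0 in Bt *; set z := t0 - c in kB *.
  have -> : t - c = s + z by rewrite /s /z; ring.
  have sz : - (`|s| * `|z|) <= s * z by rewrite -normrM lerNl -normrN ler_norm.
  have s2 : s ^+ 2 = `|s| ^+ 2 by rewrite real_normK // num_real.
  have h1 : `|s| * (k * (B - 1)) <= `|s| * (k * (`|s| - 1)).
    by apply: ler_wpM2l => //; rewrite ler_pM2l // lerD2r.
  have h2 : k * - (`|s| * `|z|) <= k * (s * z) by rewrite ler_wpM2l // ltW.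
  rewrite kB in h1.
  have h3 : 1 <= `|s| by exact: le_trans Bt.
  have -> : k * (s + z) ^+ 2 = k * `|s| ^+ 2 + 2 * (k * (s * z)) + k * z ^+ 2.
    by rewrite -s2; ring.
  have h4 : 0 <= k * `|s| by rewrite mulr_ge0 // ltW.
  lra.
have [p _ pmin] : exists2 p, `[t0 - B, t0 + B]%classic p &
    forall t, `[t0 - B, t0 + B]%classic t -> (q p <= q t)%E.
  apply: lsc_compact_min ql _ _; first exact: segment_compact.
  by exists t0; rewrite /= in_itv /=; apply/andP; split; lra.
have pall t : (q p <= q t)%E.
  have [tB|/ltW/far] := leP `|t - t0| B.
    by apply: pmin; rewrite /= in_itv /= -ler_distlC distrC.
  apply: le_trans; apply: pmin.
  by rewrite /= in_itv /=; apply/andP; split; lra.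
have [b gp] : exists b : R, g p = b%:E.
  have := pall t0; rewrite /q ga -EFinD; move: (gN p).
  by case: (g p) => [b||] // _ _; exists b.
exists p; first by rewrite gp.
move=> t tp; rewrite lt_neqAle pall andbT; apply/eqP => qpt.
have [d gt] : exists d : R, g t = d%:E.
  move: qpt; rewrite gp -EFinD; move: (gN t).
  by case: (g t) => [d||] // _ _; exists d.
move: qpt; rewrite gp gt -!EFinD => -[qpt].
(* Two minimizers would be improved by their midpoint. *)
have h01 : 0 < (2^-1 : R) < 1 by lra.
pose s : R := 2^-1 * p + (1 - 2^-1) * t.
have gs : (g s <= 2^-1%:E * g p + (1 - 2^-1)%:E * g t)%E := gc p t 2^-1 h01.
have sE : s = (p + t) / 2 by rewrite /s; lra.
rewrite gp gt -!EFinM -EFinD in gs.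
have := pall s; rewrite /q gp; move: (gN s) gs.
case: (g s) => [h||] // _; rewrite lee_fin -EFinD lee_fin sE => h1 h2.
have : 0 < k * (t - p) ^+ 2.
  by rewrite mulr_gt0 // exprn_even_gt0 //= subr_eq0.
lra.
Qed.

(** * Dot products and orthogonal families *)

Section DotProduct.
Variables (R : realType) (n : nat).
Implicit Types u v w : 'cV[R]_n.

Lemma dotvE u v : dotv u v = (u^T *m v) ord0 ord0.
Proof. by rewrite mxE; apply: eq_bigr => i _; rewrite mxE. Qed.

Lemma dotvC u v : dotv u v = dotv v u.
Proof. by apply: eq_bigr => i _; rewrite mulrC. Qed.

Lemma dotv_is_linear u : linear (dotv u : 'cV[R]_n -> R^o).
Proof.
move=> a v w; rewrite /dotv scaler_sumr -big_split; apply: eq_bigr => i _ /=.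
by rewrite !mxE /GRing.scale /=; ring.
Qed.

HB.instance Definition _ u :=
  GRing.isLinear.Build R 'cV[R]_n R^o _ (dotv u) (dotv_is_linear u).

Lemma dotvZ u k v : dotv u (k *: v) = k * dotv u v.
Proof. by rewrite linearZ. Qed.

Lemma dotv_ge0 u : 0 <= dotv u u.
Proof. by apply: sumr_ge0 => i _; rewrite -expr2 sqr_ge0. Qed.

Lemma dotv_eq0 u : dotv u u = 0 -> u = 0.
Proof.
move=> /eqP; rewrite psumr_eq0; last by move=> i _; rewrite -expr2 sqr_ge0.
move=> /allP u0; apply/colP => i; rewrite mxE.
by have := u0 i (mem_index_enum i); rewrite -expr2 sqrf_eq0 => /eqP.
Qed.

Lemma enorm_sqr u : enorm u ^+ 2 = dotv u u.
Proof. by rewrite sqr_sqrtr // dotv_ge0. Qed.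

Lemma continuous_dotv u : continuous (dotv u : 'cV[R]_n -> R).
Proof.
apply: (@continuous_big R) => [|i _]; first exact: (@add_continuous R^o).
move=> v; apply: (@continuous_comp _ _ _
  (fun w : 'cV[R]_n => w i ord0) ( *%R (u i ord0))).
  exact: coord_continuous.
exact: mulrl_continuous.
Qed.

(** When the [e m] are orthogonal with squared lengths [d m], this is the only
    vector of their span whose dot product with each [e m] is [a m]; taking for
    [a m] the dot products of a vector with [e m] gives its orthogonal
    projection. *)
Definition orthogonal_expansion (p : nat) (e : 'I_p -> 'cV[R]_n)
    (d a : 'I_p -> R) : 'cV[R]_n := \sum_(m < p) (a m / d m) *: e m.

Section Bessel.
Variables (p : nat) (e : 'I_p -> 'cV[R]_n) (d : 'I_p -> R).
Hypothesis d_gt0 : forall m, 0 < d m.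
Hypothesis e_orth : forall i j, dotv (e i) (e j) = d i * (i == j)%:R.

Lemma dotv_orthogonal_expansion a j :
  dotv (e j) (orthogonal_expansion e d a) = a j.
Proof.
rewrite linear_sum (bigD1 j) //= big1 => [|i ij].
  by rewrite linearZ /= e_orth eqxx mulr1 addr0 /GRing.scale /= mulfVK ?gt_eqF.
by rewrite linearZ /= e_orth eq_sym (negbTE ij) mulr0 scaler0.
Qed.

Lemma bessel_identity w : let z :=
    w - orthogonal_expansion e d (fun m => dotv (e m) w) in
  dotv w w = dotv z z + \sum_(m < p) dotv (e m) w ^+ 2 / d m.
Proof.
set s := orthogonal_expansion _ _ _ => z.
have sE x : dotv s x = \sum_(m < p) dotv (e m) w / d m * dotv (e m) x.
  rewrite dotvC linear_sum; apply: eq_bigr => m _.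
  by rewrite linearZ /= (dotvC x).
have sw : dotv s w = \sum_(m < p) dotv (e m) w ^+ 2 / d m.
  by rewrite sE; apply: eq_bigr => m _; rewrite mulrAC -expr2.
have ss : dotv s s = dotv s w.
  rewrite !sE; apply: eq_bigr => m _; congr (_ * _).
  exact: dotv_orthogonal_expansion.
rewrite /z linearB /= (dotvC _ w) (dotvC _ s) !linearB /= ss (dotvC w s) -sw.
by ring.
Qed.

End Bessel.

End DotProduct.

Lemma dotv_mulmx (R : realType) (m n : nat) (A : 'M[R]_(m, n)) u v :
  dotv u (A *m v) = dotv (A^T *m u) v.
Proof. by rewrite !dotvE trmx_mul trmxK mulmxA. Qed.

Lemma mulmx_dotv (R : realType) (m n : nat) (u : 'cV[R]_m) (v w : 'cV[R]_n) :
  u *m v^T *m w = dotv v w *: u.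
Proof.
rewrite -mulmxA dotvE; apply/matrixP => i j.
by rewrite mxE big_ord1 [RHS]mxE mulrC (ord1 j).
Qed.

(** A left inverse of a square matrix is a right inverse: for the matrix [O]
    with columns [o m], the hypothesis is [O^T *m O = 1%:M] and the conclusion
    [O *m O^T = 1%:M]. *)
Lemma orthonormal_resolution (R : realType) (n : nat) (o : 'I_n -> 'cV[R]_n) :
  (forall i j, dotv (o i) (o j) = (i == j)%:R) ->
  \sum_(m < n) o m *m (o m)^T = 1%:M.
Proof.
move=> ortho; pose O : 'M[R]_n := \matrix_(i, j) o j i ord0.
have /mulmx1C <- : O^T *m O = 1%:M.
  by apply/matrixP => i j; rewrite mxE [RHS]mxE -ortho; apply: eq_bigr => k _;
    rewrite !mxE.
apply/matrixP => i j; rewrite summxE mxE; apply: eq_bigr => k _.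
by rewrite !mxE big_ord1 !mxE.
Qed.

(** * Separable objectives and their minimizers *)

(** If the coordinates [a m x] and the remainder [r x] can be chosen
    independently, a separable objective has a unique minimizer: where all
    coordinates are optimal and the remainder vanishes. Finiteness of the
    [q m (p m)] is what lets one strict inequality survive the summation in the
    extended reals. *)
Lemma lte_sum_strict_minimizers (R : realType) (T : Type) (n : nat)
    (r : T -> R) (a : 'I_n -> T -> R) (q : 'I_n -> R -> \bar R)
    (p : 'I_n -> R) (x : T) :
  (forall m, q m (p m) \is a fin_num) ->
  (forall m t, t != p m -> (q m (p m) < q m t)%E) ->
  0 <= r x -> r x != 0 \/ (exists m, a m x != p m) ->
  (\sum_(m < n) q m (p m) < (r x)%:E + \sum_(m < n) q m (a m x))%E.
Proof.
move=> qfin qmin rx0 H.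
have qle m t : (q m (p m) <= q m t)%E.
  by have [->//|/qmin/ltW] := eqVneq t (p m).
have sfin P : (\sum_(m < n | P m) q m (p m))%E \is a fin_num.
  by apply/sum_fin_numP => m _ _; exact: qfin.
case: H => [rx|[m am]].
  rewrite -[ltLHS]add0e lte_leD //; last by apply: lee_sum.
  by rewrite lte_fin lt_def rx.
apply: (@lt_le_trans _ _ (\sum_(m < n) q m (a m x))%E); last first.
  by rewrite -[leLHS]add0e leeD.
rewrite (bigD1 m) //= [ltRHS](bigD1 m) //= lte_leD //.
  exact: qmin.
exact: lee_sum.
Qed.

Lemma prox_eq (R : realType) (n : nat) (phi : 'cV[R]_n -> \bar R) u p :
  (forall v, v != p -> (prox_obj phi u p < prox_obj phi u v)%E) ->
  prox phi u = p.
Proof.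
move=> pmin; have min_p : minimizer (prox_obj phi u) p.
  by move=> v; have [->|/pmin/ltW] := eqVneq v p.
apply: get_unique.
  split=> // v vmin; apply/esym/eqP/negPn/negP => /pmin.
  by rewrite ltNge vmin.
by move=> v [vmin /(_ _ min_p)].
Qed.

(** By the Bessel identity for the vectors [L^T *m o m], the objective is half
    the squared norm of the remainder [z x] plus one term for each coordinate
    [dotv (o m) (L *m x)]; the [p m] are the minimizers of these terms. The
    factor [(2 * Delta m)^-1] is the weight that the identity gives to the
    square of the m-th coordinate. *)
Lemma prox_separable_comp (R : realType) (X Y : nat) (o : 'I_Y -> 'cV[R]_Y)
    (L : 'M[R]_(Y, X)) (Delta : 'I_Y -> R) (psi : 'I_Y -> R -> \bar R)
    (phi : 'cV[R]_X -> \bar R) (p : 'I_Y -> R) (v : 'cV[R]_X) :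
  (forall m, 0 < Delta m) ->
  (forall i j, dotv (L^T *m o i) (L^T *m o j) = Delta i * (i == j)%:R) ->
  (forall x, phi x = \sum_(m < Y) psi m (dotv (o m) (L *m x)))%E ->
  (forall m, psi m (p m) \is a fin_num) ->
  (forall m t, t != p m ->
    (((2 * Delta m)^-1 * (p m - dotv (o m) (L *m v)) ^+ 2)%:E + psi m (p m) <
     ((2 * Delta m)^-1 * (t - dotv (o m) (L *m v)) ^+ 2)%:E + psi m t)%E) ->
  prox phi v = v + \sum_(m < Y)
    ((p m - dotv (o m) (L *m v)) / Delta m) *: (L^T *m o m).
Proof.
move=> D0 Lo phiE pfin pmin; set e := fun m => L^T *m o m.
pose c m := dotv (o m) (L *m v).
rewrite -/(orthogonal_expansion e Delta (fun m => p m - c m)).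
set s := orthogonal_expansion _ _ _.
pose a m x := dotv (o m) (L *m x).
pose q m t := (((2 * Delta m)^-1 * (t - c m) ^+ 2)%:E + psi m t)%E.
(* [z x] is the part of [x - v] orthogonal to all [e m]: no coordinate of
   [L *m x] in the basis [o] sees it. *)
pose z x := x - v - orthogonal_expansion e Delta (fun m => dotv (e m) (x - v)).
pose r x := 2^-1 * dotv (z x) (z x).
have eE m x : dotv (e m) (x - v) = a m x - c m.
  by rewrite /e -dotv_mulmx mulmxBr linearB.
have objE x : prox_obj phi v x = ((r x)%:E + \sum_(m < Y) q m (a m x))%E.
  rewrite /prox_obj enorm_sqr (bessel_identity D0 Lo) phiE big_split /=.
  rewrite addeA -/(z x) mulrDr EFinD; congr (_ + _ + _)%E.
  rewrite sumEFin mulr_sumr; congr _%:E; apply: eq_bigr => m _.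
  by rewrite eE invfM; ring.
have as_ m : a m (v + s) = p m.
  apply: (addIr (- c m)); rewrite -eE (addrC v) addrK.
  exact: (dotv_orthogonal_expansion D0 Lo).
have rs : r (v + s) = 0.
  rewrite /r /z (addrC v) addrK.
  rewrite [X in s - X](_ : _ = s) ?subrr ?linear0 ?mulr0 //.
  by apply: eq_bigr => m _; rewrite (dotv_orthogonal_expansion D0 Lo).
apply: prox_eq => x xs; rewrite !objE rs add0e.
under eq_bigr do rewrite as_.
apply: lte_sum_strict_minimizers => //.
- by move=> m; rewrite fin_numD pfin.
- by rewrite mulr_ge0 ?invr_ge0 // dotv_ge0.
have [|allp] := pselect (exists m, a m x != p m); [by right | left].
apply/eqP => /eqP; rewrite mulf_eq0 invr_eq0 pnatr_eq0 /= => /eqP/dotv_eq0 zx.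
move/eqP: xs; apply; rewrite -[x](subrK v) [RHS]addrC; congr (_ + _).
rewrite -[LHS](subrK
  (orthogonal_expansion e Delta (fun m => dotv (e m) (x - v)))).
rewrite -/(z x) zx add0r; apply: eq_bigr => m _; rewrite eE.
suff -> : a m x = p m by [].
by apply/eqP/negPn/negP => am; apply: allp; exists m.
Qed.

(** * The class of the composite function *)

(** Without the point [x0] the sum could be identically infinite, since the
    domains of the [psi m] need not be met simultaneously. *)
Lemma Gamma0_sum_dotv (R : realType) (n p : nat) (w : 'I_p -> 'cV[R]_n)
    (psi : 'I_p -> R -> \bar R) (x0 : 'cV[R]_n) :
  (forall m, Gamma0 (psi m : R^o -> \bar R)) ->
  (forall m, psi m (dotv (w m) x0) != +oo%E) ->
  Gamma0 (fun x => \sum_(m < p) psi m (dotv (w m) x))%E.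
Proof.
move=> psiG psi0.
have psiN m t : psi m t != -oo%E by have [] := psiG m.
split.
- move=> x; rewrite esum_eqNy; apply/existsPn => m.
  by rewrite negb_and psiN orbT.
- apply: lsc_sum => [m x|m]; first exact: psiN.
  have [_ psil _ _] := psiG m.
  exact: (@lsc_comp R _ R^o _ _ (@continuous_dotv R n (w m)) psil).
- move=> x y t t01.
  have sumZ k z : (k%:E * (\sum_(m < p) psi m (dotv (w m) z)) =
      \sum_(m < p) k%:E * psi m (dotv (w m) z))%E.
    rewrite fin_num_sume_distrr // => i j _ _.
    by apply: ltninfty_adde_def; rewrite inE ltNye psiN.
  rewrite !sumZ -big_split /=; apply: lee_sum => m _.
  have [_ _ psic _] := psiG m.
  by rewrite linearD !linearZ; exact: psic.
- exists x0; rewrite -ltey; apply: lte_sum_pinfty => m _.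
  by rewrite ltey.
Qed.

(** * The proximity operator of the composite function *)

Theorem proposition3p4 (R : realType) (X Y : nat) (X_gt0 : (0 < X)%N)
    (Y_gt0 : (0 < Y)%N)
    (o : 'I_Y -> 'cV[R]_Y) (o_basis : orthonormal_basis o)
    (psi : 'I_Y -> R -> \bar R)
    (psi_Gamma0 : forall m, Gamma0 (psi m : R^o -> \bar R))
    (Upsilon : 'cV[R]_Y -> \bar R)
    (UpsilonE : forall u, Upsilon u = (\sum_(m < Y) psi m (dotv (o m) u))%E)
    (L : 'M[R]_(Y, X)) (Delta : 'I_Y -> R)
    (Delta_gt0 : forall m, 0 < Delta m)
    (D : 'M[R]_Y) (DE : D = L *m L^T)
    (D_spectral : D = \sum_(m < Y) Delta m *: (o m *m (o m)^T))
    (DUpsilon : 'cV[R]_Y -> \bar R)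
    (DUpsilonE : forall u, DUpsilon u =
       (\sum_(m < Y) (Delta m)%:E * psi m (dotv (o m) u))%E) :
  let UpsilonL := fun x : 'cV[R]_X => Upsilon (L *m x) in
  Gamma0 UpsilonL /\
  forall v : 'cV[R]_X,
    prox UpsilonL v =
    v + L^T *m invmx D *m (prox DUpsilon (L *m v) - L *m v).
Proof.
move=> UpsilonL; have ortho := o_basis.2.
have Do m : D *m o m = Delta m *: o m.
  rewrite D_spectral mulmx_suml (bigD1 m) //= big1 => [|i im].
    by rewrite -scalemxAl mulmx_dotv ortho eqxx scale1r addr0.
  by rewrite -scalemxAl mulmx_dotv ortho (negbTE im) scale0r scaler0.
have Lo i j : dotv (L^T *m o i) (L^T *m o j) = Delta i * (i == j)%:R.
  by rewrite dotvC -dotv_mulmx mulmxA -DE Do dotvZ ortho eq_sym.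
have D_unit : D \in unitmx.
  have /mulmx1_unit[] // :
      D *m (\sum_(m < Y) (Delta m)^-1 *: (o m *m (o m)^T)) = 1%:M.
  rewrite mulmx_sumr -(orthonormal_resolution ortho); apply: eq_bigr => m _.
  by rewrite -scalemxAr mulmxA Do -scalemxAl scalerA mulVf ?scale1r ?gt_eqF.
have Dinv_o m : invmx D *m o m = (Delta m)^-1 *: o m.
  rewrite -[RHS](mulKmx D_unit) -scalemxAr Do scalerA mulVf ?scale1r //.
  by rewrite gt_eqF.
have UE x : UpsilonL x = (\sum_(m < Y) psi m (dotv (o m) (L *m x)))%E.
  exact: UpsilonE.
split.
  have [t tfin] : {t : 'I_Y -> R & forall m, psi m (t m) != +oo%E}.
    apply: (@choice _ _ (fun m x => psi m x != +oo%E)) => m.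
    by have [_ _ _ [x xfin]] := psi_Gamma0 m; exists x.
  (* Orthogonality of the [L^T *m o m] yields a point with the prescribed
     coordinates [t m], at which every term is finite. *)
  have -> : UpsilonL = fun x => (\sum_(m < Y) psi m (dotv (L^T *m o m) x))%E.
    by apply/funext => x; rewrite UE; under eq_bigr do rewrite dotv_mulmx.
  apply: (@Gamma0_sum_dotv _ _ _ _ _
    (orthogonal_expansion (fun m => L^T *m o m) Delta t)) => // m.
  by rewrite (dotv_orthogonal_expansion Delta_gt0 Lo).
move=> v; pose c m := dotv (o m) (L *m v).
pose strict_min m x := forall t, t != x ->
  (((2 * Delta m)^-1 * (x - c m) ^+ 2)%:E + psi m x <
   ((2 * Delta m)^-1 * (t - c m) ^+ 2)%:E + psi m t)%E.
have [p pP] : {p : 'I_Y -> R &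
    forall m, psi m (p m) \is a fin_num /\ strict_min m (p m)}.
  apply: (@choice _ _ (fun m x => psi m x \is a fin_num /\ strict_min m x)) => m.
  have k0 : 0 < (2 * Delta m)^-1 by rewrite invr_gt0 mulr_gt0.
  have [x xfin xmin] := quadratic_Gamma0_strict_min (c m) (psi_Gamma0 m) k0.
  by exists x.
have pfin m : psi m (p m) \is a fin_num := (pP m).1.
rewrite (prox_separable_comp Delta_gt0 Lo UE pfin); last first.
  by move=> m; exact: (pP m).2.
congr (_ + _).
(* The prox of [DUpsilon] is the case of the identity matrix with weights 1. *)
have Io i j : dotv (1%:M^T *m o i) (1%:M^T *m o j) = 1 * (i == j)%:R.
  by rewrite trmx1 !mul1mx mul1r.
rewrite (@prox_separable_comp _ _ _ o 1%:M (fun=> 1)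
  (fun m t => (Delta m)%:E * psi m t)%E _ p _ _ Io).
- rewrite addrC addKr mulmx_sumr; apply: eq_bigr => m _.
  rewrite trmx1 !mul1mx divr1 -scalemxAr -[in RHS]mulmxA Dinv_o -scalemxAr.
  by rewrite scalerA.
- by [].
- by move=> u; rewrite DUpsilonE mul1mx.
- by move=> m; rewrite fin_numM.
- move=> m t tp; rewrite mul1mx -/(c m) mulr1.
  have /(pP m).2 := tp.
  have D0 : (0 < (Delta m)%:E)%E by rewrite lte_fin.
  rewrite -(@lte_pmul2l _ (Delta m)%:E) //.
  have dist s : ((Delta m)%:E * (((2 * Delta m)^-1 * (s - c m) ^+ 2)%:E +
      psi m s) = (2^-1 * (s - c m) ^+ 2)%:E + (Delta m)%:E * psi m s)%E.
    rewrite muleDr // ?fin_num_adde_defr // -EFinM; congr (_%:E + _)%E.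
    by field; rewrite gt_eqF.
  by rewrite !dist.
Qed.
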